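(* For any normal ($T_4$) topological space $X$, the sets $\mathcal{M}(B_1(X))$ and $\mathcal{M}(B_1^*(X))$ have the same cardinality, where $\mathcal{M}(B_1(X))$ and $\mathcal{M}(B_1^*(X))$ are the collections of all maximal ideals in $B_1(X)$ and in $B_1^*(X)$ respectively.
   Context: A Baire one function on a topological space $X$ is a function $f:X\to\mathbb{R}$ that is the pointwise limit of a sequence of continuous real-valued functions on $X$. $B_1(X)$ is the commutative ring, under pointwise operations, of all Baire one functions on $X$, and $B_1^*(X)$ is its subring of bounded functions. *)

(* Defs.v *)
From HB Require Import structures.
From mathcomp Require Import all_boot all_order all_algebra.
From mathcomp Require Import all_classical all_reals all_analysis.

Set Implicit Arguments.
Unset Strict Implicit.
Unset Printing Implicit Defensive.

Import Order.TTheory GRing.Theory Num.Theory.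
Import numFieldNormedType.Exports.

Local Open Scope classical_set_scope.
Local Open Scope ring_scope.

(* The rings below are [comPzRingType]s and not [comNzRingType]s because X may
   be empty, in which case they are zero rings; this is also why the ideals of
   [ring_quotient], restricted to nonzero rings, are not used. *)
Section ideals.
Variable A : comPzRingType.
Implicit Types I J : set A.

Definition is_ideal I :=
  [/\ I 0, (forall x y, I x -> I y -> I (x + y)) & (forall a x, I x -> I (a * x))].

Definition is_maximal_ideal I :=
  [/\ is_ideal I, I <> setT &
      forall J, is_ideal J -> I `<=` J -> J = I \/ J = setT].

Definition maximal_ideals : set (set A) := [set I | is_maximal_ideal I].

End ideals.
Arguments maximal_ideals A : clear implicits.

Lemma bounded_funR_exP (R : realType) (T : Type) (f : T -> R) :
  bounded_fun f <-> exists M : R, forall x, `|f x| <= M.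
Proof.
split=> [[M [_ fM]]|[M fM]].
  by exists (M + 1) => x; apply: fM => //; rewrite ltrDl.
by exists M; split=> [|N MN x _ /=]; [exact: num_real|exact: le_trans (fM x) (ltW MN)].
Qed.

Section baire_one.
Variables (R : realType) (X : topologicalType).

Definition baire_one (f : X -> R) :=
  exists u : nat -> X -> R,
    (forall n, continuous (u n)) /\ (forall x, u n x @[n --> \oo] --> f x).

Definition baire_one_pred : {pred X -> R} := fun f => `[< baire_one f >].

Lemma baire_one_subring : subring_closed baire_one_pred.
Proof.
split=> [|f g /asboolP[u [cu uf]] /asboolP[v [cv vg]]
         |f g /asboolP[u [cu uf]] /asboolP[v [cv vg]]]; apply/asboolP.
- exists (fun=> cst 1); split=> [n x|x]; first exact: cvg_cst.
  exact: cvg_cst.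
- exists (fun n => u n \- v n); split=> [n x|x].
    by apply: cvgB; [exact: cu|exact: cv].
  by apply: cvgB; [exact: uf|exact: vg].
- exists (fun n => u n \* v n); split=> [n x|x].
    by apply: cvgM; [exact: cu|exact: cv].
  by apply: cvgM; [exact: uf|exact: vg].
Qed.

HB.instance Definition _ :=
  GRing.isSubringClosed.Build (X -> R) baire_one_pred baire_one_subring.

Record B1 := MkB1 { B1_val :> X -> R; _ : B1_val \in baire_one_pred }.

HB.instance Definition _ := [isSub for B1_val].
HB.instance Definition _ := [Choice of B1 by <:].
HB.instance Definition _ := GRing.SubChoice_isSubComPzRing.Build
  (X -> R) baire_one_pred B1 baire_one_subring.

Definition bounded_pred : {pred B1} := fun f => `[< bounded_fun (f : X -> R) >].

Lemma bounded_subring : subring_closed bounded_pred.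
Proof.
split=> [|f g /asboolP/bounded_funR_exP[M fM] /asboolP/bounded_funR_exP[N gN]
         |f g /asboolP/bounded_funR_exP[M fM] /asboolP/bounded_funR_exP[N gN]];
  apply/asboolP/bounded_funR_exP.
- by exists 1 => x; rewrite /= normr1.
- exists (M + N) => x.
  by apply: le_trans (ler_normB _ _) _; apply: lerD; [exact: fM|exact: gN].
- exists (M * N) => x.
  by rewrite [leLHS]normrM; apply: ler_pM; [| |exact: fM|exact: gN].
Qed.

HB.instance Definition _ :=
  GRing.isSubringClosed.Build B1 bounded_pred bounded_subring.

Record B1star := MkB1star { B1star_val :> B1; _ : B1star_val \in bounded_pred }.

HB.instance Definition _ := [isSub for B1star_val].
HB.instance Definition _ := [Choice of B1star by <:].
HB.instance Definition _ := GRing.SubChoice_isSubComPzRing.Build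
  B1 bounded_pred B1star bounded_subring.

End baire_one.
Arguments B1 R X : clear implicits.
Arguments B1star R X : clear implicits.

(* Main.v *)
(* A function bounded below by a positive constant is a unit of both rings, so a
   proper ideal contains none. To a maximal ideal [M] of [B1] associate the ideal
   of the bounded functions [p] such that for every [e > 0], [|p| <= e + h] for
   some [h] in [M]. It is maximal: if [p] is not in it, then [(|p| - e)^+] is not
   in [M] for some [e], and comaximality yields [h] in [M] equal to [1] where
   [|p| <= e]; then [p^2 + h^2 / (1 + h^2)] is bounded away from zero. The map is
   injective because [f^2 / (1 + f^2)] stays in the ideal when [f] is in [M], and
   a maximal ideal [N] of [B1star] is the image of any maximal ideal containing
   all the [(|p| - e)^+] with [p] in [N] and [e > 0]. *)
Require Import Defs.
From mathcomp Require Import all_boot all_order all_algebra.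
From mathcomp Require Import all_classical all_reals all_analysis.
From mathcomp Require Import lra.

Set Implicit Arguments.
Unset Strict Implicit.
Unset Printing Implicit Defensive.

Import Order.TTheory GRing.Theory Num.Theory.
Import numFieldNormedType.Exports.

Local Open Scope classical_set_scope.
Local Open Scope ring_scope.

(** * Ideals of a commutative ring: comaximality and existence of maximal ideals *)

Section ideals.
Variable A : comPzRingType.
Implicit Types (I J : set A) (a b : A).

Lemma ideal1 I : is_ideal I -> I 1 -> I = setT.
Proof.
by move=> [_ _ IM] I1; apply/seteqP; split=> // a _; rewrite -[a]mulr1; apply: IM.
Qed.

Lemma ideal_unit I a b : is_ideal I -> I a -> b * a = 1 -> I = setT.
Proof. by move=> idI Ia ba1; apply: ideal1 => //; rewrite -ba1; case: idI => _ _; apply. Qed.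

Lemma maximal_idealN1 I : is_maximal_ideal I -> ~ I 1.
Proof. by move=> [idI IT _] I1; apply/IT/ideal1. Qed.

(** The elements [b * a + h] with [h] in [I] form an ideal containing [I] and [a], hence the whole
    ring. *)
Lemma maximal_ideal_comax I a : is_maximal_ideal I -> ~ I a ->
  exists b h, I h /\ b * a + h = 1.
Proof.
move=> [[I0 ID IM] _ Imax] nIa.
pose J := [set c | exists b h, I h /\ b * a + h = c].
have idJ : is_ideal J.
  split.
  - by exists 0, 0; rewrite mul0r addr0.
  - move=> _ _ [b1 [h1 [Ih1 <-]]] [b2 [h2 [Ih2 <-]]].
    by exists (b1 + b2), (h1 + h2); split; [exact: ID | rewrite mulrDl addrACA].
  - move=> c _ [b [h [Ih <-]]].
    by exists (c * b), (c * h); split; [exact: IM | rewrite mulrDr mulrA].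
have IJ : I `<=` J by move=> h Ih; exists 0, h; rewrite mul0r add0r.
have [JI|JT] := Imax J idJ IJ; last by have : J 1 by rewrite JT.
by case: nIa; rewrite -JI; exists 1, 0; rewrite mul1r addr0.
Qed.

Lemma maximal_ideals_comax I J : is_maximal_ideal I -> is_maximal_ideal J ->
  I <> J -> exists a b, [/\ I a, J b & a + b = 1].
Proof.
move=> mI mJ IJ; have [sIJ|/existsNP[a /not_implyP[Ia nJa]]] := pselect (I `<=` J).
  case: mI => idI IT /(_ J _ sIJ)[|JI|JT]; first by case: mJ.
    by case: IJ.
  by case: mJ => _ /(_ JT).
have [b [h [Jh e]]] := maximal_ideal_comax mJ nJa.
by exists (b * a), h; split=> //; case: mI => -[_ _ IM] _ _; apply: IM.
Qed.

Lemma exists_maximal_ideal I : is_ideal I -> ~ I 1 ->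
  exists2 M, is_maximal_ideal M & I `<=` M.
Proof.
move=> idI nI1.
(* The empty chain has the empty union, hence the union with [I]. *)
pose P J := is_ideal (J `|` I) /\ ~ (J `|` I) 1.
have [F FP Ftot|J [[idJ nJ1] Jmax]] := @Zorn_bigcup A P.
  have [->|/set0P[K0 FK0]] := eqVneq F set0; first by rewrite /P bigcup_set0 set0U.
  have sub K : F K -> K `|` I `<=` \bigcup_(K in F) K `|` I.
    by move=> FK; apply: setSU; exact: bigcup_sup.
  have ex c : (\bigcup_(K in F) K `|` I) c -> exists2 K, F K & (K `|` I) c.
    by move=> [[K FK Kc]|Ic]; [exists K => //; left | exists K0 => //; right].
  split; last by move=> /ex[K /FP[_]].
  split.
  - by right; case: idI.
  - move=> a b /ex[K FK Ka] /ex[L FL Lb].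
    have [KL|LK] := Ftot K L FK FL.
      by apply: (sub L FL); have [[_ D _] _] := FP L FL; apply: D => //; exact: (setSU KL).
    by apply: (sub K FK); have [[_ D _] _] := FP K FK; apply: D => //; exact: (setSU LK).
  - move=> a b /ex[K FK Kb].
    by apply: (sub K FK); have [[_ _ D] _] := FP K FK; apply: D.
exists (J `|` I); last exact: subsetUr.
split=> // [JT|K idK JK]; first by apply: nJ1; rewrite JT.
have [K1|nK1] := pselect (K 1); [by right; exact: ideal1 | left].
(* Zorn's lemma makes [J] maximal for [P], which is not yet maximality of the union of [J] and [I].
   But [K] contains [I], so it satisfies [P] itself, and if it differed from the union it would
   strictly contain [J]. *)
apply: contrapT => KJ; apply: (Jmax K).
  split; first by apply: subset_trans JK; exact: subsetUl.
  move=> sKJ; apply: KJ; apply/seteqP; split=> //.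
  by apply: (subset_trans sKJ); exact: subsetUl.
have IK : I `<=` K by apply: subset_trans JK; exact: subsetUr.
by rewrite /P (setUidl IK).
Qed.

End ideals.

(** * Construction of Baire one functions, and units of both rings *)

Section baire_one_ideals.
Variables (R : realType) (X : topologicalType).
Local Notation B := (B1 R X).
Local Notation Bs := (B1star R X).
Implicit Types (f g h : B) (p q : Bs) (x : X).

Lemma B1D f g x : (f + g : B) x = f x + g x. Proof. by []. Qed.
Lemma B1M f g x : (f * g : B) x = f x * g x. Proof. by []. Qed.
Lemma B10 x : (0 : B) x = 0. Proof. by []. Qed.
Lemma B11 x : (1 : B) x = 1. Proof. by []. Qed.
Definition B1E := (B1D, B1M, B10, B11).

Lemma B1starD p q : ((p + q : Bs) : B) = (p : B) + q. Proof. by []. Qed.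
Lemma B1starM p q : ((p * q : Bs) : B) = (p : B) * q. Proof. by []. Qed.
Lemma B1star0 : ((0 : Bs) : B) = 0. Proof. by []. Qed.
Lemma B1star1 : ((1 : Bs) : B) = 1. Proof. by []. Qed.
Definition B1starE := (B1starD, B1starM, B1star0, B1star1).

Lemma B1_ext f g : (forall x, f x = g x) -> f = g.
Proof. by move=> fg; apply/val_inj/funext. Qed.

(** Composing with [phi] each continuous function of an approximating sequence preserves the
    pointwise limit. *)
Lemma B1_comp (phi : R -> R) f : continuous phi -> exists g, forall x, g x = phi (f x).
Proof.
move=> cphi; case: f => f /= /[dup] Bf /asboolP[u [cu uf]].
have Bg : (phi \o f) \in @baire_one_pred R X.
  apply/asboolP; exists (fun n => phi \o u n); split=> [n x|x].
    by apply: continuous_comp; [exact: cu|exact: cphi].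
  by apply: continuous_cvg; [exact: cphi|exact: uf].
by exists (MkB1 Bg).
Qed.

Lemma B1_cst (c : R) : exists g, forall x, g x = c.
Proof. by apply: (B1_comp (phi := cst c) 0) => ?; exact: cvg_cst. Qed.

Lemma B1star_intro f (K : R) : (forall x, `|f x| <= K) -> exists p, f = p.
Proof.
move=> fK; have bf : f \in @bounded_pred R X.
  by apply/asboolP/bounded_funR_exP; exists K.
by exists (MkB1star bf).
Qed.

Lemma B1star_bounded p : exists2 K : R, 0 < K & forall x, `|(p : B) x| <= K.
Proof.
case: p => f /= /asboolP/bounded_funR_exP[K fK].
exists (Num.max K 1); first by rewrite lt_max ltr01 orbT.
by move=> x; rewrite le_max fK.
Qed.

(** Truncating at [e] makes the reciprocal continuous on the whole line without changing it on the
    values of [f]. The inverse is bounded by [e^-1], so it serves in both rings. *)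
Lemma B1star_inv f (e : R) : 0 < e -> (forall x, e <= f x) ->
  exists p, (p : B) * f = 1.
Proof.
move=> e0 ef; have [|g gE] := @B1_comp (fun t => (Num.max t e)^-1) f.
  move=> t; apply: cvgV; first by rewrite gt_eqF// lt_max e0 orbT.
  by apply: continuous_max; [exact: cvg_id | exact: cvg_cst].
have gE' x : g x = (f x)^-1 by rewrite gE; congr _^-1; apply/max_idPl.
have [x|p gp] := @B1star_intro g e^-1.
  have f0 := lt_le_trans e0 (ef x).
  by rewrite gE' ger0_norm ?invr_ge0 ?(ltW f0)// lef_pV2.
exists p; rewrite -gp; apply: B1_ext => x.
by rewrite !B1E gE' mulVf// gt_eqF// (lt_le_trans e0).
Qed.

Lemma B1_ideal_lb (M : set B) f (e : R) : is_ideal M -> ~ M 1 -> M f -> 0 < e ->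
  ~ (forall x, e <= f x).
Proof.
move=> idM M1 Mf e0 /(B1star_inv e0)[p pf].
by apply: M1; rewrite (ideal_unit idM Mf pf).
Qed.

Lemma B1star_ideal_lb (N : set Bs) p (e : R) : is_ideal N -> N p -> 0 < e ->
  (forall x, e <= (p : B) x) -> N = setT.
Proof.
move=> idN Np e0 /(B1star_inv e0)[q qp].
by apply: (ideal_unit (b := q) idN Np); apply/val_inj.
Qed.

(** This function vanishes where [|f| <= e], and [|f|] is at most [e] plus it: it turns smallness of
    [f] into membership in an ideal. *)
Lemma B1_excess f (e : R) : exists h, forall x, h x = Num.max (`|f x| - e) 0.
Proof.
apply: (B1_comp (phi := fun t => Num.max (`|t| - e) 0)) => t.
apply: (@continuous_max R R (fun t => `|t| - e) (cst 0)); last exact: cvg_cst.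
by apply: cvgB; [exact: norm_continuous | exact: cvg_cst].
Qed.

(** Replaces a possibly unbounded member of [M] by a multiple of it with values in [[0, 1]] and the
    same zeros. *)
Lemma B1_ideal_bounded (M : set B) f : is_ideal M -> M f ->
  exists2 p : Bs, M p & forall x, (p : B) x = f x ^+ 2 / (1 + f x ^+ 2).
Proof.
move=> [_ _ MM] Mf; have [|q qE] := @B1star_inv (1 + f * f) 1 ltr01.
  by move=> x; rewrite !B1E lerDl -expr2 sqr_ge0.
have pE x : ((q : B) * f * f) x = f x ^+ 2 / (1 + f x ^+ 2).
  have /(congr1 (fun g : B => g x)) := qE; rewrite !B1E -expr2 => qx.
  have f0 : 1 + f x ^+ 2 != 0 by rewrite gt_eqF// ltr_pwDl// sqr_ge0.
  have -> : (q : B) x = (1 + f x ^+ 2)^-1.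
    by apply: (mulIf f0); rewrite qx mulVf.
  by rewrite -mulrA -expr2 mulrC.
have [x|p pq] := @B1star_intro ((q : B) * f * f) 1.
  have f0 := sqr_ge0 (f x); have f1 : 0 < 1 + f x ^+ 2 by rewrite ltr_pwDl.
  by rewrite pE ger0_norm ?divr_ge0 ?(ltW f1)// ler_pdivrMr// mul1r lerDr.
by exists p; rewrite -pq//; apply: MM.
Qed.

(* The bounded functions whose residue modulo [M] is infinitely small. *)
Definition infinitesimals (M : set B) : set Bs :=
  [set p | forall e : R, 0 < e -> exists2 h, M h & forall x, `|(p : B) x| <= e + h x].

Lemma infinitesimals_ideal (M : set B) : is_ideal M -> is_ideal (infinitesimals M).
Proof.
move=> [M0 MD MM]; split.
- by move=> e e0; exists 0 => // x; rewrite B1starE !B1E normr0 addr0 ltW.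
- move=> p q Mp Mq e e0; have e2 : 0 < e / 2 by rewrite divr_gt0.
  have [h Mh ph] := Mp _ e2; have [k Mk qk] := Mq _ e2.
  exists (h + k) => [|x]; first exact: MD.
  rewrite B1starE !B1E (le_trans (ler_normD _ _))//.
  by have := ph x; have := qk x; lra.
(* Boundedness of [a] is essential here: the tolerance [e / K] for [p] absorbs the bound [K] of
   [a]. *)
- move=> a p Mp e e0; have [K K0 aK] := B1star_bounded a.
  have [h Mh ph] := Mp (e / K) (divr_gt0 e0 K0); have [k kE] := B1_cst K.
  exists (k * h) => [|x]; first exact: MM.
  rewrite B1starE !B1E kE normrM (le_trans (ler_pM _ _ (aK x) (ph x)))//.
  by rewrite mulrDr mulrCA mulfV ?mulr1// gt_eqF.
Qed.

(** The witness is [p^2 / e]: either [|p| <= e], or [|p| > e] and then [|p| <= p^2 / e]. *)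
Lemma sub_infinitesimals (M : set B) p : is_ideal M -> M p -> infinitesimals M p.
Proof.
move=> [_ _ MM] Mp e e0; have [k kE] := B1_cst e^-1.
exists (k * p * p) => [|x]; first exact: MM.
rewrite !B1E kE -mulrA -expr2 -(real_normK (num_real ((p : B) x))).
set t := `|_|; have [te|et] := leP t e.
  rewrite (le_trans te)// lerDl mulr_ge0 ?invr_ge0 ?(ltW e0) ?exprn_ge0//.
  exact: normr_ge0.
rewrite ler_wpDl ?(ltW e0)// mulrC ler_pdivlMr// expr2 ler_wpM2l ?normr_ge0 //.
exact: ltW.
Qed.

Lemma infinitesimals_proper (M : set B) : is_ideal M -> ~ M 1 -> ~ infinitesimals M 1.
Proof.
have h0 : (0 : R) < 1 / 2 by rewrite divr_gt0.
move=> idM M1 /(_ _ h0)[h Mh hE].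
apply: (@B1_ideal_lb M h (1 / 2)) => // x.
by have := hE x; rewrite B1starE !B1E normr1; lra.
Qed.

(** * The bijection between maximal ideals *)

Lemma infinitesimals_maximal (M : set B) : is_maximal_ideal M ->
  is_maximal_ideal (infinitesimals M).
Proof.
move=> maxM; have [idM _ _] := maxM; have M1 := maximal_idealN1 maxM.
split; first exact: infinitesimals_ideal.
  by move=> MT; apply: (infinitesimals_proper idM M1); rewrite MT.
move=> J idJ MJ; have [JM|] := pselect (J `<=` infinitesimals M).
  by left; apply/seteqP; split.
move=> /existsNP[p /not_implyP[Jp /existsNP[e /not_implyP[e0 Mp]]]]; right.
have [g gE] := B1_excess p e.
have Mg : ~ M g.
  move=> Mg; apply: Mp; exists g => // x.
  by rewrite gE -lerBlDl le_max lexx.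
have [b [h [Mh bh]]] := maximal_ideal_comax maxM Mg.
have [q Mq qE] := B1_ideal_bounded idM Mh.
have [J0 JD JM] := idJ.
have Js : J (p * p + q).
  by apply: JD; [exact: JM | apply: MJ; exact: sub_infinitesimals].
(* Where [|p| <= e], [g] vanishes, so [h] is [1] and [q] is [1 / 2]; elsewhere [p^2] is at least
   [e^2]. *)
apply: (B1star_ideal_lb (e := Num.min (e ^+ 2) (1 / 2)) idJ Js).
  by rewrite lt_min exprn_gt0// divr_gt0.
move=> x; rewrite !B1starE !B1E qE -expr2 ge_min.
have [pe|ep] := leP `|(p : B) x| e.
  have /(congr1 (fun g : B => g x)) := bh.
  have g0 : g x = 0 by rewrite gE; apply/max_idPr; rewrite subr_le0.
  rewrite !B1E g0 mulr0 add0r => ->.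
  by apply/orP; right; rewrite expr1n ler_wpDl// sqr_ge0.
apply/orP; left; rewrite -(real_normK (num_real ((p : B) x))) ler_wpDr//.
  by rewrite divr_ge0 ?addr_ge0 ?sqr_ge0.
by rewrite ler_pXn2r ?nnegrE ?ltW// (lt_trans e0).
Qed.

Lemma infinitesimals_inj (M M' : set B) : is_maximal_ideal M -> is_maximal_ideal M' ->
  infinitesimals M = infinitesimals M' -> M = M'.
Proof.
move=> maxM maxM' MM'; apply: contrapT => /(maximal_ideals_comax maxM maxM').
move=> [f [g [Mf Mg fg]]].
have [idM _ _] := maxM; have [idM' _ _] := maxM'.
have [p Mp pE] := B1_ideal_bounded idM Mf; have [q Mq qE] := B1_ideal_bounded idM' Mg.
have [idN NT _] := infinitesimals_maximal maxM.
have Ns : infinitesimals M (p + q).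
  case: (idN) => _ D _; apply: D; first exact: sub_infinitesimals.
  by rewrite MM'; exact: sub_infinitesimals.
(* Since [f + g = 1], at each point one of the two values is at least [1 / 2], and
   [r^2 / (1 + r^2)], increasing for [r >= 0], is [1 / 5] at [r = 1 / 2]. *)
apply: NT; apply: (B1star_ideal_lb (e := 1 / 5) idN Ns); first by rewrite divr_gt0.
move=> x; rewrite B1starE !B1E pE qE.
have /(congr1 (fun g : B => g x)) := fg; rewrite !B1E.
move: (f x) (g x) => s t st.
have sq0 (r : R) : 0 <= r ^+ 2 / (1 + r ^+ 2) by rewrite divr_ge0 ?addr_ge0 ?sqr_ge0.
have sq5 (r : R) : 1 / 2 <= r -> 1 / 5 <= r ^+ 2 / (1 + r ^+ 2).
  by move=> r2; rewrite ler_pdivlMr ?ltr_pwDl ?sqr_ge0//; nra.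
have [s2|s2] := leP (1 / 2) s; first by rewrite ler_wpDr// sq5.
by rewrite ler_wpDl// sq5//; lra.
Qed.

Lemma infinitesimals_surj (N : set Bs) : is_maximal_ideal N ->
  exists2 M, is_maximal_ideal M & infinitesimals M = N.
Proof.
move=> maxN; have [idN NT Nmax] := maxN; have [N0 ND NM] := idN.
(* The functions vanishing where some [p \in N] is small: it is proper because a
   function of [N] cannot be bounded away from zero. *)
pose I : set B := [set a | exists (p : Bs) (e : R),
  [/\ N p, 0 < e & forall x, (p : B) x ^+ 2 <= e -> a x = 0]].
have idI : is_ideal I.
  split.
  - by exists 0, 1.
  - move=> a b [p [e [Np e0 pa]]] [q [d [Nq d0 qb]]].
    (* The definition of [I] squares its witness, hence the squared threshold: it gives
       [p^2 + q^2 <= Num.min e d], which bounds both squares. *)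
    exists (p * p + q * q), (Num.min e d ^+ 2); split.
    + by apply: ND; exact: NM.
    + by rewrite exprn_gt0// lt_min e0.
    have m0 : 0 < Num.min e d by rewrite lt_min e0.
    move=> x; rewrite !B1starE !B1E -!expr2.
    have p0 := sqr_ge0 ((p : B) x); have q0 := sqr_ge0 ((q : B) x).
    rewrite ler_pXn2r ?nnegrE ?addr_ge0 ?(ltW m0)// => pq.
    rewrite pa ?qb ?addr0//.
      by apply: le_trans (le_trans pq _); rewrite ?lerDr// ge_min lexx orbT.
    by apply: le_trans (le_trans pq _); rewrite ?lerDl// ge_min lexx.
  - move=> a b [p [e [Np e0 pb]]]; exists p, e; split=> // x /pb bx.
    by rewrite B1E bx mulr0.
have nI1 : ~ I 1.
  move=> [p [e [Np e0 p1]]]; apply: NT.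
  apply: (B1star_ideal_lb (p := p * p) (e := e) idN _ e0); first exact: NM.
  move=> x; rewrite B1starE !B1E -expr2 leNgt; apply/negP => /ltW/p1/eqP.
  by rewrite B1E oner_eq0.
have [M maxM IM] := exists_maximal_ideal idI nI1; exists M => //.
have [idM' MT' _] := infinitesimals_maximal maxM.
(* As [infinitesimals M] is proper, maximality of [N] reduces the equality to the inclusion of
   [N]. *)
have [||//|//] := Nmax (infinitesimals M) => //.
move=> p Np e e0; have [h hE] := B1_excess p e.
exists h => [|x]; last by rewrite hE -lerBlDl le_max lexx.
(* The excess [h] vanishes where [p^2 <= e^2], so it lies in [I]. *)
apply: IM; exists p, (e ^+ 2); split=> //; first by rewrite exprn_gt0.
move=> x; rewrite -(real_normK (num_real ((p : B) x))).
rewrite ler_pXn2r ?nnegrE ?normr_ge0 ?(ltW e0)// => pe.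
by rewrite hE; apply/max_idPr; rewrite subr_le0.
Qed.

End baire_one_ideals.

Local Open Scope card_scope.

Theorem theorem3p26 (R : realType) (X : topologicalType)
  (normalX : normal_space X) (T1X : accessible_space X) :
  maximal_ideals (B1 R X) #= maximal_ideals (B1star R X).
Proof.
apply/card_set_bijP; exists (@infinitesimals R X); split.
- by move=> M; exact: infinitesimals_maximal.
- by move=> M M' /set_mem maxM /set_mem maxM'; exact: infinitesimals_inj.
- by move=> N /infinitesimals_surj[M maxM <-]; exists M.
Qed.
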